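(* Let $(a_{n,k})_{n,k\ge 1}$ be complex numbers such that each power series $1+\sum_{k=1}^{\infty}a_{n,k}\lambda^k$ is analytic (near $\lambda=0$), the infinite product $\prod_{n=1}^{\infty}\big(1+\sum_{k=1}^{\infty}a_{n,k}\lambda^k\big)$ converges uniformly, and every series of the form $\sum_{n=1}^{\infty}\prod_{j=1}^{m}a_{n,k_j}$ ($m\in\mathbb{N}$, $k_j\in\mathbb{N}$) converges. Write $$\prod_{n=1}^{\infty}\Big(1+\sum_{k=1}^{\infty}a_{n,k}\lambda^k\Big)=1+\sum_{k=1}^{\infty}X_k\lambda^k.$$ Then for every $k\in\mathbb{N}$, $$X_k=\sum_{L\vdash k}\frac{1}{C_{stb}(L)}\sum_{\sigma\in S_{\ell(L)}}\operatorname{sign}(\sigma)\,\mathbb{A}_{\sigma,L}.$$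
   Context: $L\vdash k$ means $L=[x_1,\dots,x_m]$ is a partition of $k$: a multiset of positive integers with $\sum x_i=k$; $\ell(L)=m$ is its length. $C_{stb}(L):=\prod_{x}(\#\{i: x_i=x\})!$, the product over distinct values $x$ occurring in $L$. Write $L=[k_1,\dots,k_m]$ with $k_1\le\cdots\le k_m$. For $\sigma\in S_m$ (symmetric group, $\operatorname{sign}$ its sign), write $\sigma$ as a product of disjoint cycles $C_1,\dots,C_r$, keeping fixed points as cycles of length one; then $\mathbb{A}_{\sigma,L}:=\prod_{t=1}^{r}\big(\sum_{n=1}^{\infty}\prod_{i\in C_t}a_{n,k_i}\big)$. *)

(* Defs.v *)
(* Complex numbers are modelled as
   R[i] (mathcomp-real-closed) over an arbitrary realType R, viewed through
   the regular-algebra alias ^o so that MathComp-Analysis equips it with its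
   normed-module / topological structure. *)
From mathcomp Require Import all_boot all_order all_algebra all_fingroup.
From mathcomp Require Import complex.
From mathcomp Require Import all_classical all_reals all_analysis.
Set Implicit Arguments. Unset Strict Implicit. Unset Printing Implicit Defensive.
Import Order.TTheory GRing.Theory Num.Theory.
Import numFieldNormedType.Exports.
Local Open Scope ring_scope.

Notation Cx R := ((R[i])^o).

Definition is_partition (k : nat) (L : seq nat) : bool :=
  [&& sorted leq L, all (fun x => 0 < x)%N L & sumn L == k].

Definition bounded_seqs (k : nat) : seq (seq nat) :=
  flatten [seq [seq map (@nat_of_ord k.+1) (tval t) | t <- enum {: m.-tuple 'I_k.+1}]
          | m <- iota 0 k.+1].

Definition partitions (k : nat) : seq (seq nat) :=
  [seq L <- undup (bounded_seqs k) | is_partition k L].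

Definition Cstb (L : seq nat) : nat := \prod_(x <- undup L) (count_mem x L)`!.

(* A_{sigma,L} = prod over the cycles C of sigma (fixed points included)
   of  sum_{n>=1} prod_{i in C} a_{n,k_i},  where L = [k_1 <= ... <= k_m]
   (0-based indices here: k_i = nth 0 L i). *)
Definition bbA (R : realType) (a : nat -> nat -> Cx R) (L : seq nat)
    (s : 'S_(size L)) : Cx R :=
  \prod_(c in porbits s)
     limn (series (fun n => \prod_(i in c) a n.+1 (nth 0%N L (val i)))).

Definition pfactor_fn (R : realType) (a : nat -> nat -> Cx R) (n : nat)
    (lam : Cx R) : Cx R :=
  1 + limn (series (fun k => a n k.+1 * lam ^+ k.+1)).

(* Main.v *)
Require Import Defs.
From mathcomp Require Import all_boot all_order all_algebra all_fingroup.
From mathcomp Require Import cyclic separable cyclotomic.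
From mathcomp Require Import ring complex.
From mathcomp Require Import all_classical all_reals all_analysis.
Import Order.TTheory GRing.Theory Num.Theory.
Import numFieldNormedType.Exports.
Local Open Scope classical_set_scope.
Local Open Scope ring_scope.

(* Write [X_k(N)] for the coefficient of [lambda^k] in the product of the first
   [N] factors. Uniform convergence on a circle and Cauchy's estimate give
   [X_k(N) --> X_k]; the estimate is only needed for polynomials, where it
   follows by averaging over roots of unity, since every function involved is a
   uniform limit of polynomials on the circle.
   On the algebraic side, [X_k(N)] is the sum over [L |- k] of [1 / Cstb L]
   times the sum of [prod_i a_{f i, k_i}] over the injections
   [f : [m] -> [N]], because both sides satisfy the same recurrence when a
   factor is added. The indicator of injectivity of [f] is the determinant of
   the matrix [f i == f j], i.e. the signed count of the permutations [s] with
   [f \o s = f]; exchanging the sums over [f] and [s] leaves the functions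
   constant on the cycles of [s], whose total weight factors over the cycles.
   Each factor then converges as [N] grows. *)

(** * Roots of unity and Cauchy's estimate for polynomials *)

Lemma primitive_root_exists (C : numClosedFieldType) (n : nat) :
  (0 < n)%N -> exists z : C, n.-primitive_root z.
Proof.
(* [p] splits, and it is separable in characteristic zero, so its [n] roots are distinct; [n]
   distinct [n]-th roots of unity include a primitive one. *)
move=> n_gt0; pose p : {poly C} := 'X^n - 1.
have [r Dp] := closed_field_poly_normal p.
rewrite (monicP _) ?monicXnsubC // scale1r in Dp.
have rn1 : all n.-unity_root r by apply/allP=> z; rewrite -root_prod_XsubC -Dp.
have sz_r : (n < (size r).+1)%N.
  by rewrite -(size_prod_XsubC r id) -Dp size_XnsubC.
have [|z _ zP] := hasP (has_prim_root n_gt0 rn1 _ sz_r); last by exists z.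
by rewrite -separable_prod_XsubC -Dp separable_Xn_sub_1 // pnatr_eq0 -lt0n.
Qed.

Lemma sum_expr_unity_root (F : fieldType) (n : nat) (q : F) :
  q ^+ n = 1 -> q != 1 -> \sum_(j < n) q ^+ j = 0.
Proof.
move=> qn q1; have /eqP := subrX1 q n.
by rewrite qn subrr eq_sym mulf_eq0 subr_eq0 (negbTE q1) => /eqP.
Qed.

(* Cauchy's coefficient estimate, by averaging over the points [rho * z ^+ j]
   for a primitive root of unity [z] of order [size p]. *)
Lemma poly_coef_norm_le (C : numClosedFieldType) (p : {poly C}) (rho eps : C)
    (k : nat) :
  0 < rho -> (forall z : C, `|z| = rho -> `|p.[z]| <= eps) ->
  `|p`_k| * rho ^+ k <= eps.
Proof.
move=> rho0 pb; have [kM|Mk] := ltnP k (size p); last first.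
  rewrite nth_default // normr0 mul0r.
  by apply: le_trans (pb rho _); rewrite // gtr0_norm.
set M := size p in kM; have M0 : (0 < M)%N by apply: leq_trans kM.
have [z zP] := primitive_root_exists C _ M0.
have z0 : z != 0.
  apply/eqP => z0; have /eqP := prim_expr_order zP.
  by rewrite z0 expr0n gtn_eqF// eq_sym oner_eq0.
have z1 : `|z| = 1.
  apply/eqP; rewrite -(pexpr_eq1 M0) ?normr_ge0// -normrX.
  by rewrite (prim_expr_order zP) normr1.
(* Only the term [i = k] survives: for other [i < M] the ratio [z ^+ i / z ^+ k] is an [M]-th root
   of unity different from 1, and its powers sum to 0. *)
have avg : \sum_(j < M) p.[rho * z ^+ j] * (z ^+ k) ^- j
           = M%:R * (p`_k * rho ^+ k).
  transitivity (\sum_(i < M) p`_i * rho ^+ i *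
                 \sum_(j < M) (z ^+ i / z ^+ k) ^+ j).
    under eq_bigr do rewrite horner_coef mulr_suml.
    rewrite exchange_big; apply: eq_bigr => i _; rewrite mulr_sumr.
    apply: eq_bigr => j _; rewrite exprMn expr_div_n -!exprM -!mulrA.
    by rewrite (mulnC i j).
  rewrite (bigD1 (Ordinal kM)) //= [X in _ + X]big1 ?addr0 => [|i ik].
    rewrite divff ?expf_neq0//; under eq_bigr do rewrite expr1n.
    by rewrite sumr_const card_ord mulrC.
  rewrite sum_expr_unity_root ?mulr0//.
    by rewrite expr_div_n -!exprM !(mulnC _ M) !exprM (prim_expr_order zP) !expr1n divr1.
  rewrite -subr_eq0 -(divff (expf_neq0 k z0)) -mulrBl mulf_neq0 ?invr_eq0 ?expf_neq0//.
  by rewrite subr_eq0 (eq_prim_root_expr zP) !modn_small.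
have M0' : 0 < M%:R :> C by rewrite ltr0n.
rewrite -(ler_pM2l M0').
have -> : M%:R * (`|p`_k| * rho ^+ k) = `|M%:R * (p`_k * rho ^+ k)|.
  by rewrite !normrM normr_nat normrX (gtr0_norm rho0).
rewrite -avg (le_trans (ler_norm_sum _ _ _))//.
have -> : M%:R * eps = \sum_(j < M) eps by rewrite sumr_const card_ord mulr_natl.
apply: ler_sum => j _; rewrite normrM normfV !normrX z1 !expr1n invr1 mulr1.
by apply: pb; rewrite normrM normrX z1 expr1n mulr1 gtr0_norm.
Qed.

(** * Sums over pairwise distinct indices *)

Fixpoint injsum {A : comPzRingType} {I : finType} {T : Type} (a : I -> T -> A)
    (S : {set I}) (L : seq T) : A :=
  if L is x :: L' then \sum_(n in S) a n x * injsum a (S :\ n) L' else 1.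

(** Indices being distinct, the new index [n] is used either nowhere or at exactly one position [i],
    and the other positions then choose from [S]. *)
Lemma injsum_setU1 {A : comPzRingType} {I : finType} {T : Type}
    (a : I -> T -> A) (x0 : T) (n : I) (S : {set I}) (L : seq T) :
  n \notin S ->
  injsum a (n |: S) L = injsum a S L +
    \sum_(i < size L) a n (nth x0 L i) * injsum a S (take i L ++ drop i.+1 L).
Proof.
elim: L S => [|x L IH] S nS /=; first by rewrite big_ord0 addr0.
rewrite big_setU1 //= setU1K // big_ord_recl /= ?take0 ?drop0 /= addrCA; congr (_ + _).
under [X in _ = _ + X]eq_bigr do rewrite mulr_sumr.
rewrite exchange_big -big_split /=; apply: eq_bigr => n' n'S.
have nn' : n != n' by apply: contraNneq nS => ->.
have -> : (n |: S) :\ n' = n |: (S :\ n').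
  by apply/setP => y; rewrite !inE; case: (y =P n) => [->|]; rewrite ?nn' ?andbF.
rewrite IH ?inE ?(negbTE nS) ?andbF// mulrDr; congr (_ + _).
by rewrite mulr_sumr; apply: eq_bigr => i _; rewrite mulrCA.
Qed.

Lemma injsum_tupleE {A : comPzRingType} {I : finType} {T : Type}
    (a : I -> T -> A) (x0 : T) (S : {set I}) (L : seq T) :
  injsum a S L = \sum_(t : (size L).-tuple I | uniq t && all [in S] t)
                   \prod_(i < size L) a (tnth t i) (nth x0 L i).
Proof.
elim: L S => [|x L IH] S /=.
  rewrite (big_pred1 [tuple]) ?big_ord0// => t.
  by rewrite (tuple0 t) /= eqxx.
rewrite (reindex (fun p : I * (size L).-tuple I => [tuple of p.1 :: p.2])) /=; last first.
  exists (fun t => (thead t, [tuple of behead t])) => [[n t] _|t _] /=.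
    by congr pair; apply: val_inj.
  by rewrite [RHS]tuple_eta.
under eq_bigr do rewrite IH mulr_sumr.
rewrite pair_big_dep /=; apply: eq_big => [[n t]|[n t] _] /=.
  case: (n \in S) => /=; last by rewrite andbF.
  rewrite -andbA andbCA; congr (_ && _).
  elim: (tval t) => //= y s IHs; rewrite IHs in_cons in_setD1 negb_or (eq_sym n).
  by case: (y \in S); rewrite ?andbF// !andbT andbA.
rewrite big_ord_recl tnth0; congr (_ * _); apply: eq_bigr => i _.
by rewrite tnthS.
Qed.

Lemma injsum_ffunE {A : comPzRingType} {I : finType} {T : Type}
    (a : I -> T -> A) (x0 : T) (L : seq T) :
  injsum a (finset.setTfor I) L = \sum_(f : {ffun 'I_(size L) -> I} | injectiveb f)
                   \prod_(i < size L) a (f i) (nth x0 L i).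
Proof.
rewrite (injsum_tupleE _ x0).
rewrite (reindex (fun f : {ffun 'I_(size L) -> I} => [tuple f i | i < size L])) /=; last first.
  exists (fun t : (size L).-tuple I => [ffun i => tnth t i]) => [f _|t _].
    by apply/ffunP => i; rewrite ffunE tnth_mktuple.
  by apply: eq_from_tnth => i; rewrite tnth_mktuple ffunE.
apply: eq_big => [f|f _]; last by apply: eq_bigr => i _; rewrite tnth_mktuple.
rewrite [X in _ && X](_ : _ = true) ?andbT; last by apply/allP => y _; rewrite inE.
by rewrite /injectiveb /dinjectiveb.
Qed.

(** * Cycles of permutations and signed sums *)

Lemma porbit_invariant (T : finType) (J : Type) (s : {perm T}) (f : T -> J) :
  (forall i, f (s i) = f i) -> forall i j, i \in porbit s j -> f i = f j.
Proof.
move=> fs i j /porbitP[n ->]; elim: n => [|n IH]; first by rewrite expg0 perm1.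
by rewrite expgSr permM fs.
Qed.

(** Expanding the product chooses one index per cycle, which amounts to a function constant on the
    cycles. *)
Lemma prod_porbits (A : comPzRingType) (T I : finType) (j0 : I)
    (b : I -> T -> A) (s : {perm T}) :
  \prod_(c in porbits s) \sum_n \prod_(i in c) b n i =
  \sum_(f : {ffun T -> I} | [forall i, f (s i) == f i]) \prod_i b (f i) i.
Proof.
rewrite (big_distr_big j0).
(* [h] reads [f] at some element of each cycle and is [j0] on all other sets. The functions [g] that
   satisfy [h (h' g) = g] are thus those equal to [j0] off the cycles, which is the index set of the
   expanded product. *)
pose h (f : {ffun T -> I}) : {ffun {set T} -> I} :=
  [ffun c : {set T} => if c \in porbits s then
                         if [pick i in c] is Some i then f i else j0
                       else j0].
pose h' (g : {ffun {set T} -> I}) : {ffun T -> I} := [ffun i => g (porbit s i)].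
have orbs (g : {ffun {set T} -> I}) i : h' g (s i) = h' g i.
  rewrite !ffunE; congr (g _); apply/eqP; rewrite eq_porbit_mem.
  by have := mem_porbit s 1 i; rewrite expg1.
have pickP' i c : porbit s i = c -> exists2 j, j \in porbit s i & [pick i in c] = Some j.
  move=> <-; case: pickP => [j jc|/(_ i)]; first by exists j.
  by rewrite porbit_id.
rewrite [RHS](reindex_onto h' h) => [|f /forallP fs]; last first.
  apply/ffunP => i; rewrite !ffunE imset_f //=.
  have [j ij ->] := pickP' i _ erefl.
  by apply: porbit_invariant ij => k; apply/eqP.
apply: eq_big => [g|g _]; last first.
  rewrite [RHS](partition_big (porbit s) [in porbits s]) /=; last by move=> i _; apply: imset_f.
  apply: eq_bigr => c /imsetP[j _ ->].
  apply: eq_big => i; first by rewrite -eq_porbit_mem.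
  by rewrite -eq_porbit_mem => /eqP ij; rewrite ffunE ij.
have -> /= : [forall i, h' g (s i) == h' g i] by apply/forallP => i; apply/eqP.
apply/pffun_onP/eqP => [[sg _]|<-].
  apply/ffunP => c; rewrite ffunE; case: ifP => [/imsetP[i _ ci]|cN].
    have [j ji ->] := pickP' i c (esym ci).
    by rewrite ffunE ci; congr (g _); apply/eqP; rewrite eq_porbit_mem.
  apply/eqP/negPn/negP => gc; move/fintype.subsetP: sg => /(_ c).
  by rewrite !inE eq_sym gc => /(_ isT); rewrite cN.
split=> [|x _]; last by [].
by apply/fintype.subsetP => c; rewrite !inE ffunE; case: ifP; rewrite ?eqxx.
Qed.

(* The left-hand side is the determinant of the matrix [f i == f j], which is
   the identity if [f] is injective and has two equal rows otherwise. *)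
Lemma sum_sign_stabilizer (A : comNzRingType) (m : nat) (J : eqType)
    (f : 'I_m -> J) :
  \sum_(s : 'S_m | [forall i, f (s i) == f i]) (-1) ^+ s
  = (injectiveb f)%:R :> A.
Proof.
pose M : 'M[A]_m := \matrix_(i, j) (f i == f j)%:R.
transitivity (\det M).
  rewrite big_mkcond; apply: eq_bigr => s _.
  case: ifPn => [/forallP fs|/forallPn[i fi]].
    by rewrite big1 ?mulr1// => i _; rewrite mxE eq_sym fs.
  by rewrite (bigD1 i) //= mxE eq_sym (negbTE fi) mul0r mulr0.
case: injectiveP => [fi|].
  rewrite -[RHS](det1 A m); congr (\det _); apply/matrixP => i j.
  by rewrite !mxE (inj_eq fi).
move=> nf; case: (boolP [exists i, [exists j, (i != j) && (f i == f j)]]).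
  move=> /existsP[i /existsP[j /andP[ij /eqP fij]]].
  by apply: determinant_alternate ij _ => k; rewrite !mxE fij.
move=> /existsPn H; case: nf => i j fij; apply/eqP.
by have /existsPn/(_ j) := H i; rewrite fij eqxx andbT negbK.
Qed.

Lemma sum_sign_prod_porbits (A : comNzRingType) (m : nat) (I : finType) (j0 : I)
    (b : I -> 'I_m -> A) :
  \sum_(s : 'S_m) (-1) ^+ s *
    \prod_(c in porbits s) \sum_n \prod_(i in c) b n i =
  \sum_(f : {ffun 'I_m -> I} | injectiveb f) \prod_i b (f i) i.
Proof.
under eq_bigr do rewrite (prod_porbits _ _ _ j0) mulr_sumr.
rewrite (exchange_big_dep predT) //= [RHS]big_mkcond /=; apply: eq_bigr => f _.
rewrite -mulr_suml sum_sign_stabilizer.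
by case: (injectiveb f); rewrite ?mul1r ?mul0r.
Qed.

(** * Partitions and removal of a part *)

Lemma mem_partitions (k : nat) (L : seq nat) :
  (L \in partitions k) = is_partition k L.
Proof.
rewrite mem_filter mem_undup; apply: andb_idr => /and3P[_ Lpos /eqP Lk].
have sizeL : (size L <= sumn L)%N.
  elim: L Lpos {Lk} => //= x L IH /andP[x0 /IH]; rewrite -add1n; exact: leq_add.
have maxL : {in L, forall x, (x <= sumn L)%N}.
  elim: (L) => //= x s IH y; rewrite inE => /orP[/eqP->|/IH]; first exact: leq_addr.
  by move=> /leq_trans; apply; rewrite leq_addl.
apply/flatten_mapP; exists (size L); first by rewrite mem_iota add0n ltnS -Lk.
apply/mapP; exists (map_tuple inord (in_tuple L)); first by rewrite mem_enum.
rewrite /= -map_comp -[LHS]map_id; apply/eq_in_map => x /maxL xL /=.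
by rewrite inordK// ltnS -Lk.
Qed.

Lemma uniq_partitions (k : nat) : uniq (partitions k).
Proof. by rewrite filter_uniq ?undup_uniq. Qed.

(** Values absent from [L] contribute [0! = 1]. This allows [Cstb] of [L] and of [rem x L] to be
    compared over one index list. *)
Lemma Cstb_sub (L s : seq nat) : uniq s -> {subset L <= s} ->
  Cstb L = (\prod_(x <- s) (count_mem x L)`!)%N.
Proof.
move=> us Ls; rewrite [RHS](bigID [in L]) /= [X in (_ * X)%N]big1 ?muln1 => [|x].
  rewrite -[RHS]big_filter; apply: perm_big; apply: uniq_perm.
  - exact: undup_uniq.
  - exact: filter_uniq.
  - by move=> x; rewrite mem_undup mem_filter andb_idr//; apply: Ls.
by move=> /count_memPn ->.
Qed.

Lemma Cstb_rem (x : nat) (L : seq nat) : x \in L ->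
  Cstb L = (count_mem x L * Cstb (rem x L))%N.
Proof.
move=> xL; rewrite (Cstb_sub (rem x L) (undup L)) ?undup_uniq//; last first.
  by move=> y /mem_rem; rewrite mem_undup.
rewrite /Cstb !(bigD1_seq x) ?mem_undup ?undup_uniq//= mulnA.
rewrite count_mem_rem eqxx subn1; congr (_ * _)%N.
  have : (0 < count_mem x L)%N by rewrite -has_count has_pred1.
  by case: (count_mem x L) => // n _; rewrite factS.
apply: eq_bigr => y yx; rewrite count_mem_rem [x == y]eq_sym (negbTE yx) subn0//.
Qed.

(** [rem] deletes the first occurrence, which may precede position [i]; both results are
    nevertheless sorted lists with the same entries. *)
Lemma rem_nth_sorted (L : seq nat) (i : nat) : sorted leq L -> (i < size L)%N ->
  take i L ++ drop i.+1 L = rem (nth 0%N L i) L.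
Proof.
move=> sL iL; apply: (sorted_eq leq_trans anti_leq).
- apply: (subseq_sorted leq_trans _ sL).
  by rewrite -[X in subseq _ X](cat_take_drop i) cat_subseq// (drop_nth 0%N iL) subseq_cons.
- exact: (subseq_sorted leq_trans (rem_subseq _ _) sL).
rewrite -(perm_cons (nth 0%N L i)) (perm_trans _ (perm_to_rem _)) ?mem_nth//.
rewrite -[X in perm_eq _ X](cat_take_drop i) (drop_nth 0%N iL).
by rewrite -cat1s perm_catCA.
Qed.

(** The inverse map inserts [x] and sorts. *)
Lemma partitions_rem (k x : nat) : (0 < x <= k)%N ->
  perm_eq [seq rem x L | L <- partitions k & x \in L] (partitions (k - x)).
Proof.
move=> /andP[x0 xk]; apply: uniq_perm; last 2 first.
- exact: uniq_partitions.
- move=> L; apply/mapP/idP => [[L']|].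
    rewrite mem_filter mem_partitions => /and3P[xL' sL' /andP[pL' /eqP kL']] ->.
    rewrite mem_partitions /is_partition.
    rewrite (subseq_sorted leq_trans (rem_subseq _ _) sL') /=.
    have /perm_sumn := perm_to_rem xL'; have := perm_to_rem xL' => /perm_all H /=.
    rewrite kL' => ->; rewrite addKn eqxx andbT.
    by move: pL'; rewrite H /= => /andP[].
  rewrite mem_partitions => /and3P[sL pL /eqP kL].
  have pe : perm_eq (sort leq (x :: L)) (x :: L) by rewrite perm_sort.
  exists (sort leq (x :: L)).
    rewrite mem_filter mem_partitions mem_sort mem_head /is_partition.
    rewrite sort_sorted ?(perm_all _ pe) ?(perm_sumn pe); last exact: leq_total.
    by rewrite /= x0 pL kL subnKC// eqxx.
  apply: (sorted_eq leq_trans anti_leq) => //.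
    apply: (subseq_sorted leq_trans (rem_subseq _ _)).
    exact: (sort_sorted leq_total).
  rewrite -(perm_cons x) perm_sym (perm_trans _ pe)// perm_sym perm_to_rem//.
  by rewrite mem_sort mem_head.
rewrite map_inj_in_uniq; first exact/filter_uniq/uniq_partitions.
move=> L L'.
rewrite mem_filter mem_partitions => /and3P[xL sL _].
rewrite mem_filter mem_partitions => /and3P[xL' sL' _] e.
apply: (sorted_eq leq_trans anti_leq) => //.
by rewrite (perm_trans (perm_to_rem xL))// e perm_sym perm_to_rem.
Qed.

(** * Coefficients of a finite product of factors *)

Definition trunc_factor {F : nzRingType} (a : nat -> F) (K : nat) : {poly F} :=
  \poly_(j < K.+1) (if j is 0%N then 1 else a j).

(** Positions of [L] are grouped by their value [x]; the multiplicity of [x] turns the weight of [L]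
    into that of [rem x L], by [Cstb_rem]. Exchanging sums then leaves all partitions of [k - x]. *)
Lemma sum_nth_rem {F : numFieldType} (k : nat) (g : nat -> F)
    (T : seq nat -> F) :
  \sum_(L <- partitions k) (Cstb L)%:R^-1 *
     (\sum_(i < size L) g (nth 0%N L i) * T (take i L ++ drop i.+1 L)) =
  \sum_(j < k) g j.+1 *
     \sum_(L <- partitions (k - j.+1)) (Cstb L)%:R^-1 * T L.
Proof.
transitivity (\sum_(L <- partitions k) \sum_(j < k | j.+1 \in L)
     g j.+1 * ((Cstb (rem j.+1 L))%:R^-1 * T (rem j.+1 L))).
  apply: eq_big_seq => L; rewrite mem_partitions => /and3P[sL pL /eqP kL].
  have -> : \sum_(i < size L) g (nth 0%N L i) * T (take i L ++ drop i.+1 L)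
          = \sum_(x <- L) g x * T (rem x L).
    rewrite [RHS](big_nth 0%N) big_mkord; apply: eq_bigr => i _.
    by rewrite rem_nth_sorted.
  have -> : \sum_(x <- L) g x * T (rem x L)
     = \sum_(x <- undup L) (count_mem x L)%:R * (g x * T (rem x L)).
    rewrite -[LHS]big_undup_iterop_count; apply: eq_bigr => x _.
    by rewrite mulr_natl; case: (count_mem x L).
  (* Each part of [L] is positive and at most [k], hence of the form [j.+1] with [j < k]. *)
  have -> : \sum_(j < k | j.+1 \in L) g j.+1 * ((Cstb (rem j.+1 L))%:R^-1 * T (rem j.+1 L))
    = \sum_(x <- undup L) g x * ((Cstb (rem x L))%:R^-1 * T (rem x L)).
    rewrite -(big_mkord (fun j => j.+1 \in L)
       (fun j => g j.+1 * ((Cstb (rem j.+1 L))%:R^-1 * T (rem j.+1 L)))).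
    rewrite -(big_map S [in L] (fun j => g j * ((Cstb (rem j L))%:R^-1 * T (rem j L)))).
    rewrite -big_filter; apply: perm_big; apply: uniq_perm.
    - by rewrite filter_uniq// map_inj_uniq ?iota_uniq// => ? ? [].
    - exact: undup_uniq.
    move=> x; rewrite mem_filter mem_undup; apply: andb_idr => xL.
    have x0 := allP pL _ xL; apply/mapP; exists x.-1; last by rewrite prednK.
    rewrite mem_index_iota /= prednK// -kL.
    by rewrite (perm_sumn (perm_to_rem xL)) leq_addr.
  rewrite mulr_sumr; apply: eq_big_seq => x; rewrite mem_undup => xL.
  have c0 : (count_mem x L)%:R != 0 :> F.
    by rewrite pnatr_eq0 -lt0n -has_count has_pred1.
  by rewrite (Cstb_rem _ _ xL) natrM invfM -mulrA [X in _ * X]mulrCA mulKf// mulrCA.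
rewrite (exchange_big_dep predT) //=; apply: eq_bigr => j _.
rewrite -mulr_sumr; congr (_ * _); rewrite -[LHS]big_filter.
have /partitions_rem pe : (0 < j.+1 <= k)%N by rewrite ltn_ord.
by rewrite -(perm_big _ pe) big_map.
Qed.

(** Induction on the cardinal of [S]: splitting off a factor [n] gives a convolution on the left,
    which [injsum_setU1] and [sum_nth_rem] reproduce on the right. *)
Lemma coef_prod_trunc_factor {F : numFieldType} {I : finType}
    (a : I -> nat -> F) (S : {set I}) (K k : nat) : (k <= K)%N ->
  (\prod_(n in S) trunc_factor (a n) K)`_k =
  \sum_(L <- partitions k) (Cstb L)%:R^-1 * injsum a S L.
Proof.
elim: {S}#|S| {-2}S (erefl #|S|) k => [|c IH] S cS k kK.
  have -> : S = finset.set0 by apply/eqP; rewrite -cards_eq0 cS.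
  rewrite big_set0 coef1; case: k kK => [|k] _.
    have pe : perm_eq (partitions 0) [:: [::]].
      apply: uniq_perm; [exact: uniq_partitions|by []|] => L.
      rewrite mem_partitions inE /is_partition; case: L => [|x L] //=.
      by rewrite addn_eq0 eqn0Ngt; case: (0 < x)%N; rewrite ?andbF.
    by rewrite (perm_big _ pe) big_seq1 /= mulr1 /Cstb big_nil invr1.
  rewrite big_seq big1// => -[|x L]; rewrite mem_partitions; first by rewrite /is_partition andbF.
  by rewrite /= big_set0 mulr0.
have [n nS] : exists n, n \in S by apply/card_gt0P; rewrite cS.
have cS' : #|S :\ n| = c by move: cS; rewrite (cardsD1 n) nS => -[].
rewrite -(finset.setD1K nS) big_setU1 ?inE ?eqxx//= coefM big_ord_recl.
have co j : (j <= K)%N -> (trunc_factor (a n) K)`_j = if j is 0%N then 1 else a n j.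
  by move=> jK; rewrite coef_poly ltnS jK.
rewrite co// mul1r subn0 IH//.
have nS' : n \notin S :\ n by rewrite !inE eqxx.
under [RHS]eq_bigr do rewrite (injsum_setU1 _ 0%N _ _ _ nS') mulrDr.
rewrite big_split /=; congr (_ + _).
rewrite sum_nth_rem; apply: eq_bigr => i _.
by rewrite co ?IH// ?(leq_trans _ kK)// leq_subr.
Qed.

(** * Uniform polynomial approximation on a circle *)

Definition poly_approx {C : numFieldType} (rho : C) (G : C -> C)
    (p : nat -> {poly C}) :=
  forall e : C, 0 < e -> exists K0, forall K, (K0 <= K)%N ->
    forall z, `|z| = rho -> `|G z - (p K).[z]| <= e.

Lemma poly_approx_bounded {C : numFieldType} (rho : C) (G : C -> C)
    (p : nat -> {poly C}) : 0 < rho -> poly_approx rho G p ->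
  exists2 B : C, 0 <= B & forall z, `|z| = rho -> `|G z| <= B.
Proof.
move=> rho0 /(_ 1 ltr01)[K /(_ _ (leqnn K)) Gp].
exists (1 + \sum_(i < size (p K)) `|(p K)`_i| * rho ^+ i).
  rewrite addr_ge0// sumr_ge0// => i _.
  by rewrite mulr_ge0// exprn_ge0// ltW.
move=> z zr; rewrite -[G z](subrK (p K).[z]) (le_trans (ler_normD _ _))//.
rewrite lerD ?Gp// horner_coef (le_trans (ler_norm_sum _ _ _))//.
by apply: ler_sum => i _; rewrite normrM normrX zr.
Qed.

Lemma poly_approxM {C : numFieldType} (rho : C) (G H : C -> C)
    (p q : nat -> {poly C}) : 0 < rho ->
  poly_approx rho G p -> poly_approx rho H q ->
  poly_approx rho (fun z => G z * H z) (fun K => p K * q K).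
Proof.
move=> rho0 Gp Hq e e0.
have [B B0 GB] := poly_approx_bounded _ _ _ rho0 Gp.
have [D D0 HD] := poly_approx_bounded _ _ _ rho0 Hq.
(* [D] bounds [H], and [B + 1] bounds [p K] once it is within 1 of [G]; the added 1 also keeps the
   divisor positive. *)
have BD0 : 0 < D + (B + 1) by rewrite ltr_wpDl// ltr_wpDl.
have [K1 Gp1] := Gp 1 ltr01.
have [K2 Gp2] := Gp (e / (D + (B + 1))) (divr_gt0 e0 BD0).
have [K3 Hq3] := Hq (e / (D + (B + 1))) (divr_gt0 e0 BD0).
exists (maxn K1 (maxn K2 K3)) => K; rewrite !geq_max => /and3P[K1K K2K K3K] z zr.
rewrite hornerM.
have -> : G z * H z - (p K).[z] * (q K).[z] =
  (G z - (p K).[z]) * H z + (p K).[z] * (H z - (q K).[z]).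
  by rewrite mulrBl mulrBr addrA subrK.
rewrite (le_trans (ler_normD _ _))// !normrM.
have -> : e = e / (D + (B + 1)) * D + (B + 1) * (e / (D + (B + 1))).
  by rewrite [X in _ + X]mulrC -mulrDr divfK// gt_eqF.
apply: lerD; apply: ler_pM => //; [exact: Gp2|exact: HD| |exact: Hq3].
have -> : (p K).[z] = G z - (G z - (p K).[z]) by rewrite opprB addrC subrK.
by rewrite (le_trans (ler_normB _ _))// lerD ?GB ?Gp1.
Qed.

Lemma poly_approx_prod {C : numFieldType} (rho : C) (I : Type) (s : seq I)
    (G : I -> C -> C) (p : I -> nat -> {poly C}) : 0 < rho ->
  (forall i, poly_approx rho (G i) (p i)) ->
  poly_approx rho (fun z => \prod_(i <- s) G i z)
                  (fun K => \prod_(i <- s) p i K).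
Proof.
move=> rho0 Gp; elim: s => [|i s IH].
  move=> e e0; exists 0%N => K _ z _.
  by rewrite !big_nil hornerC subrr normr0 ltW.
move=> e e0; have [K0 H] := poly_approxM _ _ _ _ _ rho0 (Gp i) IH _ e0.
by exists K0 => K K0K z zr; rewrite !big_cons; apply: H.
Qed.

(* No geometric series (hence no completeness) is needed: the terms at radius
   [2 * rho] tend to [0], so the tail at radius [rho] is bounded by
   [e * (1 - 2^-N)]. *)
Lemma power_series_tail_le {C : numFieldType} (c : nat -> C) (rho e : C)
    (n N : nat) (z : C) : 0 <= e ->
  (forall k, (n <= k)%N -> `|c k * (2 * rho) ^+ k.+1| <= e) -> `|z| = rho ->
  `|\sum_(n <= k < N) c k * z ^+ k.+1| <= e * (1 - 2^-1 ^+ N).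
Proof.
move=> e0 ce zr.
have h0 : 0 <= 2^-1 :> C by rewrite invr_ge0.
have h1 : 2^-1 <= 1 :> C by rewrite invf_le1// ler1n.
elim: N => [|N IH]; first by rewrite big_geq// normr0 expr0 subrr mulr0.
have [nN|Nn] := leqP n N; last first.
  rewrite big_geq// normr0 mulr_ge0// subr_ge0.
  exact: exprn_ile1.
rewrite big_nat_recr//= (le_trans (ler_normD _ _))//.
have -> : e * (1 - 2^-1 ^+ N.+1) = e * (1 - 2^-1 ^+ N) + e * 2^-1 ^+ N.+1.
  by rewrite exprS; field.
apply: lerD IH _.
have -> : c N * z ^+ N.+1 = c N * (2 * z) ^+ N.+1 * 2^-1 ^+ N.+1.
  by rewrite -mulrA -exprMn mulrAC divff ?mul1r// pnatr_eq0.
rewrite normrM [X in _ * X <= _]ger0_norm ?exprn_ge0// ler_wpM2r ?exprn_ge0//.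
have := ce N nN; rewrite !normrM !normrX !normrM zr [`|rho|]ger0_norm//.
by rewrite -zr.
Qed.

Lemma trunc_factor_horner {F : numFieldType} (a : nat -> F) (K : nat) (z : F) :
  (trunc_factor a K).[z] = 1 + \sum_(k < K) a k.+1 * z ^+ k.+1.
Proof. by rewrite horner_poly big_ord_recl expr0 mulr1. Qed.

Lemma trunc_factor_approx (R : realType) (a : nat -> Cx R) (rho : Cx R)
    (G : Cx R -> Cx R) : 0 < rho ->
  cvgn (series (fun k => a k.+1 * (2 * rho) ^+ k.+1)) ->
  (forall z : Cx R, `|z| = rho ->
     series (fun k => a k.+1 * z ^+ k.+1) @ \oo --> G z - 1) ->
  @poly_approx R[i] rho G (trunc_factor a).
Proof.
move=> rho0 /cvg_series_cvg_0/cvgr0Pnorm_le a0 aG e e0.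
have e20 : 0 < e / 2 :> R[i] by rewrite divr_gt0.
have [K0 _ aK0] := a0 _ e20.
exists K0 => K K0K z zr.
have /cvgrPdist_le/(_ _ e20)[N0 _ HN0] := aG _ zr.
(* [N0] depends on [z], but the bound on the block from [K] to [N] does not involve it, so [K0]
   serves the whole circle. *)
pose N := maxn N0 K.
have := HN0 N (leq_maxl _ _).
rewrite /series /= (@big_cat_nat _ _ _ K) ?leq_maxr//= big_mkord => HN.
have tail : `|\sum_(K <= k < N) a k.+1 * z ^+ k.+1| <= e / 2.
  have := @power_series_tail_le R[i] (fun k => a k.+1) rho (e / 2) K N z (ltW e20).
  move=> /(_ _ zr) H; apply: le_trans (H _) _.
    by move=> k Kk; apply: aK0; apply: leq_trans Kk.
  by rewrite ler_piMr ?(ltW e20)// gerBl exprn_ge0// invr_ge0.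
rewrite trunc_factor_horner [e]splitr.
move: HN tail; set A := \sum_(k < K) _; set B := \sum_(K <= k < N) _.
move=> HN tail; have -> : G z - (1 + A) = (G z - 1 - (A + B)) + B by ring.
by rewrite (le_trans (ler_normD _ _))// lerD.
Qed.

(** * Passage to the limit in the number of factors *)

Lemma uniform_cvg_dist (R : realType) (A : set (Cx R)) (f : nat -> Cx R -> Cx R)
    (P : Cx R -> Cx R) (e : R[i]) : {uniform A, f @ \oo --> P} -> 0 < e ->
  exists N0, forall N, (N0 <= N)%N -> forall z, A z -> `|P z - f N z| <= e.
Proof.
move=> fP e0.
have nP : nbhs (P : {uniform` A -> Cx R})
               [set g | forall y, A y -> `|P y - g y| <= e].
  apply/uniform_nbhs; exists [set xy | ball xy.1 e xy.2]; split.
    exact: (entourage_ball _ (PosNum e0)).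
  by move=> g /= Pg y Ay; apply: ltW; exact: Pg.
by have [N0 _ H] := fP _ nP; exists N0 => N /H.
Qed.

(* The coefficient of [lambda ^ k] in the product of the first [N] factors, by
   [coef_prod_trunc_factor]. *)
Definition prod_coef (R : realType) (a : nat -> nat -> Cx R) (k N : nat) : Cx R :=
  \sum_(L <- partitions k) (Cstb L)%:R^-1 *
    injsum (fun (n : 'I_N) j => a n.+1 j) (finset.setTfor 'I_N) L.

Lemma prod_coef_cvg (R : realType) (a : nat -> nat -> Cx R) (X : nat -> Cx R)
    (r : Cx R) (P : Cx R -> Cx R) (k : nat) : 0 < r ->
  (forall n : nat, (0 < n)%N -> forall lam : Cx R, `|lam| < r ->
     cvgn (series (fun k => a n k.+1 * lam ^+ k.+1))) ->
  {uniform [set lam : Cx R | `|lam| < r],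
     (fun N : nat => fun lam : Cx R =>
        \prod_(1 <= n < N.+1) pfactor_fn a n lam) @ \oo --> P} ->
  (forall lam : Cx R, `|lam| < r ->
     series (fun k => X k.+1 * lam ^+ k.+1) @ \oo --> P lam - 1) ->
  (0 < k)%N -> prod_coef R a k @ \oo --> X k.
Proof.
move=> r0 ser unif serX k0.
(* With this radius [2 * rho] still lies strictly inside the disc, as [trunc_factor_approx]
   requires. *)
pose rho : R[i] := r / 4.
have rho0 : 0 < rho by rewrite divr_gt0.
have rhoE : r = 4 * rho by rewrite mulrC divfK// pnatr_eq0.
have rho2 : `|2 * rho : Cx R| < r.
  rewrite gtr0_norm ?mulr_gt0// [X in _ < X]rhoE ltr_pM2r//.
  by rewrite ltr_nat.
have rho1 (z : Cx R) : `|z| = rho -> `|z| < r.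
  by move=> ->; rewrite [X in _ < X]rhoE ltr_pMl// ltr1n.
have PX : @poly_approx R[i] rho P (trunc_factor X).
  apply: trunc_factor_approx => // [|z zr]; last exact/serX/rho1.
  by apply/cvg_ex; exists (P (2 * rho) - 1); apply: serX.
have fa n : @poly_approx R[i] rho (pfactor_fn a n.+1) (trunc_factor (a n.+1)).
  apply: trunc_factor_approx => // [|z zr]; first exact: ser.
  by rewrite /pfactor_fn addrAC subrr add0r; apply: ser => //; apply: rho1.
apply/cvgrPdist_le => e e0.
(* One third for each error: truncating the series of [P], replacing [P] by [N] factors, and
   truncating these factors. *)
pose d : R[i] := e * rho ^+ k / 3.
have d0 : 0 < d by rewrite divr_gt0// mulr_gt0// exprn_gt0.
have [N0 H0] := uniform_cvg_dist _ _ _ _ _ unif d0.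
exists N0 => // N /= N0N.
have [K1 H1] := PX _ d0.
have [K2 H2] := poly_approx_prod rho _ (index_enum 'I_N)
  (fun n : 'I_N => pfactor_fn a n.+1) _ rho0 (fun n => fa n) _ d0.
(* [K] is chosen after [N]; taking it at least [k] keeps the coefficient of degree [k] intact under
   truncation. *)
pose K := maxn k (maxn K1 K2).
pose q := trunc_factor X K - \prod_(n < N) trunc_factor (a n.+1) K.
have qk : q`_k = X k - prod_coef R a k N.
  rewrite coefB; congr (_ - _).
    by rewrite coef_poly ltnS leq_maxl; case: (k) k0.
  have := @coef_prod_trunc_factor R[i] _ (fun n : 'I_N => a n.+1) (finset.setTfor 'I_N) K k (leq_maxl _ _).
  by under eq_bigl do rewrite finset.in_setT.
rewrite -qk -(ler_pM2r (exprn_gt0 k rho0)).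
apply: poly_coef_norm_le => // z zr.
have := H0 _ N0N z (rho1 _ zr); have := H1 K _ z zr; have := H2 K _ z zr.
rewrite !leq_max !leqnn !orbT => /(_ isT) h2 /(_ isT) h1.
rewrite (@big_add1 _ _ _ 0 N.+1 xpredT) /= big_mkord => h0.
rewrite /q hornerD hornerN.
set g := \prod_(n < N) pfactor_fn a n.+1 z in h0 h2 *.
set u := (trunc_factor X K).[z] in h1 *.
set v := (\prod_(n < N) trunc_factor (a n.+1) K).[z] in h2 *.
have -> : e * rho ^+ k = d + d + d by rewrite /d; field.
have -> : u - v = - (P z - u) + (P z - g) + (g - v) by ring.
rewrite (le_trans (ler_normD _ _))// lerD// (le_trans (ler_normD _ _))//.
by rewrite lerD// normrN.
Qed.

(** A finite product of limits, one per cycle; a cycle is nonempty and its parts are positive, so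
    the convergence hypothesis covers its series. *)
Lemma bbA_partial_cvg (R : realType) (a : nat -> nat -> Cx R) (L : seq nat)
    (s : 'S_(size L)) :
  (forall ks : seq nat, ks != [::] -> all (fun j => 0 < j)%N ks ->
     cvgn (series (fun n => \prod_(j <- ks) a n.+1 j))) ->
  all (fun x => 0 < x)%N L ->
  (fun N => \prod_(c in porbits s) \sum_(n < N) \prod_(i in c)
     a n.+1 (nth 0%N L i)) @ \oo --> bbA a s.
Proof.
move=> ser posL; apply: cvg_big; first exact: mul_continuous.
move=> c /imsetP[i _ ->].
have -> : (fun N => \sum_(n < N) \prod_(j in porbit s i) a n.+1 (nth 0%N L j))
  = series (fun n => \prod_(j in porbit s i) a n.+1 (nth 0%N L j)).
  by apply/funext => N; rewrite /series /= big_mkord.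
pose ks := [seq nth 0%N L (val j) | j <- enum (porbit s i)].
have := ser ks; rewrite (_ : (fun n => _) =
    fun n => \prod_(j in porbit s i) a n.+1 (nth 0%N L j)); last first.
  by apply/funext => n; rewrite big_map big_enum.
apply.
  rewrite -size_eq0 size_map -cardE -lt0n; apply/card_gt0P.
  by exists i; apply: porbit_id.
by apply/allP => _ /mapP[j _ ->]; apply: (allP posL); apply/mem_nth/ltn_ord.
Qed.

Lemma prod_coef_cvg_bbA (R : realType) (a : nat -> nat -> Cx R) (k : nat) :
  (forall ks : seq nat, ks != [::] -> all (fun j => 0 < j)%N ks ->
     cvgn (series (fun n => \prod_(j <- ks) a n.+1 j))) ->
  prod_coef R a k @ \oo -->
    \sum_(L <- partitions k)
       ((Cstb L)%:R)^-1 * \sum_(s : 'S_(size L)) (-1) ^+ s * bbA a s.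
Proof.
move=> ser; pose A (L : seq nat) (s : 'S_(size L)) (N : nat) : Cx R :=
  \prod_(c in porbits s) \sum_(n < N) \prod_(i in c) a n.+1 (nth 0%N L i).
have cA : (fun N => \sum_(L <- partitions k) ((Cstb L)%:R)^-1 *
       \sum_(s : 'S_(size L)) (-1) ^+ s * A L s N) @ \oo -->
    \sum_(L <- partitions k)
       ((Cstb L)%:R)^-1 * \sum_(s : 'S_(size L)) (-1) ^+ s * bbA a s.
  under eq_fun do rewrite big_seq; rewrite [X in nbhs X]big_seq.
  apply: cvg_big; first exact: add_continuous.
  move=> L; rewrite mem_partitions => /and3P[_ posL _].
  apply: cvgMl_tmp; apply: cvg_big; first exact: add_continuous.
  by move=> s _; apply: cvgMl_tmp; apply: bbA_partial_cvg.
(* The two sequences are compared from [N = 1] on, because the expansion over cycles needs a default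
   index [ord0]. *)
apply: cvg_trans cA; apply: near_eq_cvg; exists 1%N => // -[|N] //= _.
apply: eq_bigr => L _; rewrite (injsum_ffunE _ 0%N); congr (_ * _).
exact: (sum_sign_prod_porbits _ _ _ ord0 (fun (n : 'I_N.+1) i => a n.+1 (nth 0%N L i))).
Qed.

Theorem mainTheorem2 (R : realType) (a : nat -> nat -> Cx R) (X : nat -> Cx R) :
  (exists (r : Cx R) (P : Cx R -> Cx R),
     [/\ 0 < r,
       (* each power series 1 + sum_k a_{n,k} lambda^k converges on the disc *)
       (forall n : nat, (0 < n)%N -> forall lam : Cx R, `|lam| < r ->
          cvgn (series (fun k => a n k.+1 * lam ^+ k.+1))),
       (* the infinite product converges uniformly on the disc, to P *)
       {uniform [set lam : Cx R | `|lam| < r],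
          (fun N : nat => fun lam : Cx R => \prod_(1 <= n < N.+1) pfactor_fn a n lam) @ \oo
          --> P}
     & (* P(lambda) = 1 + sum_{k>=1} X_k lambda^k on the disc *)
       (forall lam : Cx R, `|lam| < r ->
          series (fun k => X k.+1 * lam ^+ k.+1) @ \oo --> P lam - 1)]) ->
  (* every series sum_{n>=1} prod_{j=1}^m a_{n,k_j} (m >= 1, k_j >= 1) converges *)
  (forall ks : seq nat, ks != [::] -> all (fun j => 0 < j)%N ks ->
     cvgn (series (fun n => \prod_(j <- ks) a n.+1 j))) ->
  forall k : nat, (0 < k)%N ->
    X k = \sum_(L <- partitions k)
            ((Cstb L)%:R)^-1 * \sum_(s : 'S_(size L)) (-1) ^+ s * bbA a s.
Proof.
move=> [r [P [r0 ser unif serX]]] serA k k0.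
have cX := prod_coef_cvg _ _ _ _ _ _ r0 ser unif serX k0.
have cA := prod_coef_cvg_bbA _ _ k serA.
exact: (cvg_unique (@norm_hausdorff R[i] (Cx R)) cX cA).
Qed.
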